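(* Let $h\colon\mathbb{N}_2\to\mathbb{C}$ be a light weight. Suppose that $D_h(1)_2$ exists and $\sum_{n\ge1}|b_n^h|<1$. Then $B_h(1)_2$ exists, $B_h(1)_2\ne0$, $A_h(1)_2$ exists and $$A_h(1)_2=\Big(1-\frac{1}{B_h(1)_2}\Big)D_h(1)_2.$$
   Context: $\mathbb{N}=\{1,2,\dots\}$, $\mathbb{N}_0=\{0,1,2,\dots\}$, and $\mathbb{N}_2=\{e\subset\mathbb{N}:|e|=2\}$. A weight is a map $h\colon\mathbb{N}_2\to\mathbb{C}$. A walk of length $n\in\mathbb{N}_0$ is a tuple $w=\langle v_0,\dots,v_n\rangle$ of elements of $\mathbb{N}$ with $v_{i-1}\ne v_i$ for $i=1,\dots,n$; its weight is $h(w)=\prod_{i=1}^n h(\{v_{i-1},v_i\})$ (and $h(w)=1$ if $n=0$). A series $\sum_{x\in X}g(x)$ over an at most countable set $X$ converges absolutely if the sums $\sum_{x\in Y}|g(x)|$ over finite $Y\subset X$ are bounded; then its sum is independent of the order of summation. For a set $W$ of walks, $h(W)$ denotes the sum of $\sum_{w\in W}h(w)$ when it converges absolutely. $W(n)$ is the set of walks of length $n$ with $v_0=1$. The weight $h$ is light if $\sum_{w\in W(n)}h(w)$ converges absolutely for every $n\in\mathbb{N}_0$. Define, in $\mathbb{C}[[x]]$: $A_h(x)=\sum_{n\ge0}a_n^hx^n$ with $a_n^h=h(W(1,n))$, where $W(1,n)$ is the set of walks in $W(n)$ with $v_i=1$ for some $i\in\{1,\dots,n\}$; $B_h(x)=\sum_{n\ge0}b_n^hx^n$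 with $b_n^h=h(W_b(n))$, where $W_b(n)$ is the set of walks of length $n$ with $v_0=v_n=1$; $D_h(x)=\sum_{n\ge0}d_n^hx^n$ with $d_n^h=h(W(n))$. For $U(x)=\sum_{n\ge0}u_nx^n\in\mathbb{C}[[x]]$, we say $U(1)_2$ exists if $\sum_{n\ge0}|u_n|<\infty$, and then $U(1)_2=\sum_{n\ge0}u_n$. *)

(* Defs.v *)
From mathcomp Require Import all_boot all_order all_algebra finmap.
From mathcomp Require Import all_classical all_reals.
From mathcomp Require Import ereal sequences esum.
From mathcomp Require Import complex.

Set Implicit Arguments.
Unset Strict Implicit.
Unset Printing Implicit Defensive.

Import Order.TTheory GRing.Theory Num.Theory.
Local Open Scope classical_set_scope.
Local Open Scope ring_scope.

(* [`|z|] lives in [R[i]]; [cabs z] is the same modulus as an element of [R]. *)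
Definition cabs (R : realType) (z : R[i]) : R := ComplexField.Normc.normc z.

Section AbsoluteConvergence.
Context {R : realType} {T : choiceType}.
Implicit Types (X : set T) (g : T -> R[i]).

(* [\esum] is the supremum in [\bar R] of the sums over finite [Y `<=` X], so
   this says that these finite sums of moduli are bounded. *)
Definition abs_summable X g : Prop :=
  (\esum_(x in X) (cabs (g x))%:E < +oo)%E.

(* Convergence along the directed set of finite subsets of [X]. *)
Definition has_sum X g (s : R[i]) : Prop :=
  forall e : R, 0 < e ->
    exists2 Y0, fsets X Y0 &
      forall Y, fsets X Y -> Y0 `<=` Y -> cabs (\sum_(x \in Y) g x - s) < e.

(* Meaningful only under [abs_summable X g]; [0] if there is no sum. *)
Definition csum X g : R[i] := xget 0 (has_sum X g).

End AbsoluteConvergence.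

Definition posnat : Type := {n : nat | (0 < n)%N}.

Definition pos1 : posnat := exist _ 1%N isT.

Definition edge : Type := {e : {fset posnat} | #|` e|%fset == 2}.

Definition weight (R : realType) : Type := edge -> R[i].

(* [h({u, v})]; the value [0] for [u = v] is never used on a walk. *)
Definition edge_weight (R : realType) (h : weight R) (u v : posnat) : R[i] :=
  if insub [fset u; v]%fset is Some e then h e else 0.

(* In [nth pos1 w i] the default value is irrelevant: [i] is always at most the
   length [n] of the walk [w], whose vertex list has size [n.+1]. *)
Definition is_walk (n : nat) (w : seq posnat) : Prop :=
  size w = n.+1 /\
  forall i, (i < n)%N -> nth pos1 w i <> nth pos1 w i.+1.

Definition walk_weight (R : realType) (h : weight R) (w : seq posnat) : R[i] :=
  \prod_(i < (size w).-1) edge_weight h (nth pos1 w i) (nth pos1 w i.+1).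

Definition W (n : nat) : set (seq posnat) :=
  [set w | is_walk n w /\ nth pos1 w 0 = pos1].

Definition W1 (n : nat) : set (seq posnat) :=
  [set w | W n w /\ exists i, (1 <= i <= n)%N /\ nth pos1 w i = pos1].

Definition Wb (n : nat) : set (seq posnat) :=
  [set w | is_walk n w /\ nth pos1 w 0 = pos1 /\ nth pos1 w n = pos1].

Definition weight_of (R : realType) (h : weight R) (V : set (seq posnat)) :
  R[i] := csum V (walk_weight h).

Definition light (R : realType) (h : weight R) : Prop :=
  forall n, abs_summable (W n) (walk_weight h).

(* A formal power series is its sequence of coefficients. *)
Definition fps (R : realType) : Type := nat -> R[i].

Definition A_ (R : realType) (h : weight R) : fps R :=
  fun n => weight_of h (W1 n).
Definition B_ (R : realType) (h : weight R) : fps R :=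
  fun n => weight_of h (Wb n).
Definition D_ (R : realType) (h : weight R) : fps R :=
  fun n => weight_of h (W n).

(* Existence and value of [U(1)_2]. *)
Definition exists_at1 (R : realType) (U : fps R) : Prop :=
  abs_summable [set: nat] U.
Definition at1 (R : realType) (U : fps R) : R[i] := csum [set: nat] U.

(* Main.v *)
Require Import Defs.
From mathcomp Require Import all_boot all_order all_algebra.
From mathcomp Require Import all_classical all_reals.
From mathcomp Require Import topology normedtype ereal sequences esum.
From mathcomp Require Import complex.
From mathcomp Require Import lra zify.

Import Order.TTheory GRing.Theory Num.Theory.
Local Open Scope classical_set_scope.
Local Open Scope ring_scope.

(* Let [S] be the series of the walks from 1 that never return to 1. Cutting a
   walk at its last visit to 1 gives [D = B S], and [A = D - S]. Since [b_0 = 1]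
   and [q = |b_1| + |b_2| + ... < 1], the identity
   [s_n = d_n - (b_1 s_(n-1) + ... + b_n s_0)] shows that the partial sums [t]
   of [|s_n|] satisfy [t <= |d_0| + |d_1| + ... + q t], so [S(1)] exists. Then
   [D(1) = B(1) S(1)] by the Cauchy product, and [|B(1) - 1| <= q < 1]. *)

(** * The complex modulus as a real number *)

Section Modulus.
Local Open Scope complex_scope.
Context {R : realType}.
Implicit Types (z w : R[i]) (r : R).

Lemma cabs0 : cabs (0 : R[i]) = 0.
Proof. exact: ComplexField.Normc.normc0. Qed.

Lemma cabs0_eq0 z : cabs z = 0 -> z = 0.
Proof. exact: ComplexField.Normc.eq0_normc. Qed.

Lemma cabsM z w : cabs (z * w) = cabs z * cabs w.
Proof. exact: ComplexField.Normc.normcM. Qed.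

Lemma cabs_ge0 z : 0 <= cabs z.
Proof. by case: z => a b; apply: sqrtr_ge0. Qed.

Lemma cabsD z w : cabs (z + w) <= cabs z + cabs w.
Proof. exact: le_normcD. Qed.

Lemma cabsN z : cabs (- z) = cabs z.
Proof. exact: normcN. Qed.

Lemma cabs_real r : cabs r%:C = `|r|.
Proof. by rewrite /cabs/= expr0n/= addr0 sqrtr_sqr. Qed.

Lemma normr_Re_le z : `|complex.Re z| <= cabs z.
Proof.
case: z => a b; rewrite -sqrtr_sqr /cabs/= ler_sqrt ?lerDl ?sqr_ge0//.
by rewrite addr_ge0 ?sqr_ge0.
Qed.

Lemma normr_Im_le z : `|complex.Im z| <= cabs z.
Proof.
case: z => a b; rewrite -sqrtr_sqr /cabs/= ler_sqrt ?lerDr ?sqr_ge0//.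
by rewrite addr_ge0 ?sqr_ge0.
Qed.

Lemma cabs_sum (I : Type) (s : seq I) (P : pred I) (f : I -> R[i]) :
  cabs (\sum_(i <- s | P i) f i) <= \sum_(i <- s | P i) cabs (f i).
Proof.
elim/big_rec2: _ => [|i x y _ le_yx]; first by rewrite cabs0.
by rewrite (le_trans (cabsD _ _))// lerD2l.
Qed.

End Modulus.

(** * Unordered sums of absolutely convergent complex families *)

Section Summation.
Local Open Scope complex_scope.
Context {R : realType}.
Implicit Types T : choiceType.

Lemma cabs_fsum T (X : set T) (g : T -> R[i]) : finite_set X ->
  cabs (\sum_(x \in X) g x) <= \sum_(x \in X) cabs (g x).
Proof. by move=> Xfin; rewrite !fsbig_finite//; apply: cabs_sum. Qed.

Lemma abs_summableD T (X : set T) (f g : T -> R[i]) :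
  abs_summable X f -> abs_summable X g -> abs_summable X (fun x => f x + g x).
Proof.
move=> sf sg; apply: le_lt_trans (lte_add_pinfty sf sg).
rewrite -esumD; try by move=> *; rewrite lee_fin cabs_ge0.
by apply: le_esum => x _; rewrite -EFinD lee_fin cabsD.
Qed.

Lemma le_abs_summable T (X : set T) (f g : T -> R[i]) :
  (forall x, X x -> cabs (f x) <= cabs (g x)) ->
  abs_summable X g -> abs_summable X f.
Proof. by move=> le_fg; apply: le_lt_trans; apply: le_esum => x /le_fg. Qed.

(** One inequality suffices: applied to [c^-1] and [c * f] it yields the other. The case [c = 0] is
    separate. *)
Lemma esumZ {T} {X : set T} {c : R} {f : T -> R} : 0 <= c ->
  (\esum_(x in X) (c * f x)%:E = c%:E * \esum_(x in X) (f x)%:E)%E.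
Proof.
have le (c' : R) (f' : T -> R) : 0 <= c' ->
    (\esum_(x in X) (c' * f' x)%:E <= c'%:E * \esum_(x in X) (f' x)%:E)%E.
  move=> c0; apply: ge_ereal_sup => _ [Y [Yfin YX] <-].
  rewrite fsumEFin// -mulr_fsumr EFinM -fsumEFin// lee_wpmul2l ?lee_fin//.
  by apply: esum_ge; exists Y.
rewrite le_eqVlt => /orP[/eqP <-|c_gt0].
  by rewrite mul0e; apply: esum1 => x _; rewrite mul0r.
apply/eqP; rewrite eq_le le ?(ltW c_gt0)//= muleC -lee_pdivlMr//.
rewrite muleC (le_trans _ (le c^-1 (fun x => c * f x) _))//;
  last by rewrite invr_ge0 ltW.
by apply: le_esum => x _; rewrite mulrA mulVf ?mul1r// gt_eqF.
Qed.

Lemma abs_summableZ T (X : set T) (c : R[i]) (f : T -> R[i]) :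
  abs_summable X f -> abs_summable X (fun x => c * f x).
Proof.
rewrite /abs_summable => sf; under eq_esum do rewrite cabsM.
rewrite (esumZ (cabs_ge0 c)).
by rewrite lte_mul_pinfty// ?lee_fin ?cabs_ge0.
Qed.

Lemma sub_abs_summable {T} {X : set T} (Y : set T) (f : T -> R[i]) :
  Y `<=` X -> abs_summable X f -> abs_summable Y f.
Proof.
move=> YX; apply: le_lt_trans; apply: ge_ereal_sup => _ [Z [Zfin ZY] <-].
by apply: esum_ge; exists Z => //; split => //; apply: subset_trans YX.
Qed.

(* Splitting into positive and negative parts of real and imaginary parts
   reduces every linear statement about [csum] to nonnegative real terms, where
   [esum] is available. *)
Lemma abs_summable_ind {T} {X : set T} (P : (T -> R[i]) -> Prop) :
    (forall f : T -> R, (forall x, 0 <= f x) ->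
      abs_summable X (fun x => (f x)%:C) -> P (fun x => (f x)%:C)) ->
    (forall f g, abs_summable X f -> abs_summable X g -> P f -> P g ->
      P (fun x => f x + g x)) ->
    (forall c f, abs_summable X f -> P f -> P (fun x => c * f x)) ->
  forall g, abs_summable X g -> P g.
Proof.
move=> Pnneg PD PZ g sg.
(* [PD] and [PZ] ask for summability, so it is carried along with [P]. *)
pose Q f := abs_summable X f /\ P f.
have QD f1 f2 : Q f1 -> Q f2 -> Q (fun x => f1 x + f2 x).
  by move=> [? ?] [? ?]; split; [exact: abs_summableD|exact: PD].
have QZ c f1 : Q f1 -> Q (fun x => c * f1 x).
  by move=> [? ?]; split; [exact: abs_summableZ|exact: PZ].
have Qreal (f : T -> R) : (forall x, `|f x| <= cabs (g x)) ->
    Q (fun x => (f x)%:C).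
  move=> fg.
  have Qnneg (f1 : T -> R) : (forall x, 0 <= f1 x <= `|f x|) ->
      Q (fun x => (f1 x)%:C).
    move=> f1f; have f10 x : 0 <= f1 x by have /andP[] := f1f x.
    have sf1 : abs_summable X (fun x => (f1 x)%:C).
      apply: le_abs_summable sg => x _; rewrite cabs_real ger0_norm//.
      by apply: le_trans (fg x); have /andP[] := f1f x.
    by split=> //; apply: Pnneg.
  (* Positive part minus negative part; both lie between 0 and [|f x|], hence are dominated by
     [cabs (g x)]. *)
  have -> : (fun x => (f x)%:C) =
      (fun x => (Num.max (f x) 0)%:C + (-1) * (Num.max (- f x) 0)%:C).
    apply/funext => x; rewrite mulN1r -raddfB/=; congr _%:C.
    by rewrite /Num.max; case: ltP => ?; case: ltP => ?; lra.
  apply: QD; last apply: QZ; apply: Qnneg => x; rewrite /Num.max.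
    by case: ltP => ?; rewrite ?ler_norm ?lexx ?normr_ge0//; lra.
  case: ltP => ?; rewrite ?lexx ?normr_ge0//.
  by rewrite -normrN ler_norm; lra.
have -> : g = (fun x => (complex.Re (g x))%:C + 'i * (complex.Im (g x))%:C).
  by apply/funext => x; rewrite -complexE.
have [_ //] : Q (fun x => (complex.Re (g x))%:C + 'i * (complex.Im (g x))%:C).
apply: QD; last apply: QZ; apply: Qreal => x; first exact: normr_Re_le.
exact: normr_Im_le.
Qed.

(** The union of the two finite sets is again admissible, so a single finite sum is within [e / 2]
    of both values. This makes the choice in [csum] determinate. *)
Lemma has_sum_unique {T} (X : set T) (g : T -> R[i]) s t :
  has_sum X g s -> has_sum X g t -> s = t.
Proof.
move=> gs gt; apply/eqP; rewrite -subr_eq0; apply/eqP/cabs0_eq0.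
apply/eqP; rewrite eq_le cabs_ge0 andbT.
apply/ler_addgt0Pl => e e0; rewrite addr0.
have e20 : 0 < e / 2 by rewrite divr_gt0.
have [Y [Yfin YX] sY] := gs _ e20; have [Z [Zfin ZX] tZ] := gt _ e20.
have YZ : fsets X (Y `|` Z).
  by split; [rewrite finite_setU|rewrite subUset].
have := sY _ YZ (@subsetUl _ _ _); have := tZ _ YZ (@subsetUr _ _ _).
set u := \sum_(x \in _) _; move=> ut us.
have -> : s - t = (u - t) + - (u - s) by rewrite opprB [RHS]addrC subrKA.
by rewrite (le_trans (cabsD _ _))// cabsN; lra.
Qed.

Lemma csum_eq {T} {X : set T} {g : T -> R[i]} s : has_sum X g s -> csum X g = s.
Proof.
move=> gs; apply: (@has_sum_unique _ X g) => //.
by apply: xgetPex; exists s.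
Qed.

(** Finite sums of nonnegative terms grow with the index set, so once one exceeds [S - e], all
    larger ones lie between [S - e] and the supremum [S]. Summability makes [S] finite, so [fine]
    loses nothing. *)
Lemma has_sum_nneg {T} (X : set T) (f : T -> R) : (forall x, 0 <= f x) ->
    abs_summable X (fun x => (f x)%:C) ->
  has_sum X (fun x => (f x)%:C) (fine (\esum_(x in X) (f x)%:E))%:C.
Proof.
move=> f0 sf.
have Sfin : \esum_(x in X) (f x)%:E \is a fin_num.
  rewrite ge0_fin_numE ?esum_ge0//; last by move=> *; rewrite lee_fin.
  move: sf; rewrite /abs_summable.
  by under eq_esum do rewrite cabs_real ger0_norm//.
set S := fine _; have SE : (S%:E = \esum_(x in X) (f x)%:E)%E by rewrite fineK.
move=> e e0.
have le_S Y : fsets X Y -> \sum_(x \in Y) f x <= S.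
  move=> XY; rewrite -lee_fin SE -fsumEFin; last by case: XY.
  by apply: esum_ge; exists Y.
have [_ [Y XY <-]] : exists2 y,
    [set (\sum_(x \in Y) (f x)%:E)%E | Y in fsets X] y & ((S - e)%:E < y)%E.
  by apply: ereal_sup_gt; rewrite -/(esum _ _) -SE lte_fin; lra.
case: (XY) => Yfin _; rewrite fsumEFin// lte_fin => SY; exists Y => // Z XZ YZ.
case: (XZ) => Zfin _.
have -> : \sum_(x \in Z) (f x)%:C = (\sum_(x \in Z) f x)%:C.
  by rewrite !fsbig_finite//= rmorph_sum.
rewrite -raddfB cabs_real distrC ger0_norm ?subr_ge0 ?le_S//.
suff : \sum_(x \in Y) f x <= \sum_(x \in Z) f x by lra.
rewrite -lee_fin -!fsumEFin// lee_fsum_nneg_subset//.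
  by move=> x; rewrite !inE => /YZ.
by move=> *; rewrite lee_fin.
Qed.

Lemma has_sumD {T} (X : set T) (f g : T -> R[i]) s t :
  has_sum X f s -> has_sum X g t -> has_sum X (fun x => f x + g x) (s + t).
Proof.
move=> fs gt e e0; have e20 : 0 < e / 2 by rewrite divr_gt0.
have [Y [Yfin YX] sY] := fs _ e20; have [Z [Zfin ZX] tZ] := gt _ e20.
exists (Y `|` Z); first by split; [rewrite finite_setU|rewrite subUset].
move=> V XV; rewrite subUset => -[/(sY _ XV) VS /(tZ _ XV) VT].
rewrite fsbig_split/=; last by case: XV.
by rewrite opprD addrACA (le_lt_trans (cabsD _ _))//; lra.
Qed.

Lemma has_sumZ {T} (X : set T) c (f : T -> R[i]) s :
  has_sum X f s -> has_sum X (fun x => c * f x) (c * s).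
Proof.
move=> fs e e0.
(* Adding 1 keeps the divisor positive when [c = 0]. *)
have c1 : 0 < cabs c + 1 by have := cabs_ge0 c; lra.
have [Y XY sY] := fs _ (divr_gt0 e0 c1); exists Y => // Z XZ YZ.
rewrite -mulr_fsumr -mulrBr cabsM.
have := sY _ XZ YZ; rewrite ltr_pdivlMr//; apply: le_lt_trans.
by rewrite mulrC ler_wpM2l ?cabs_ge0// lerDl.
Qed.

(** Existence of a sum passes through [abs_summable_ind]; from here on the default value of [xget]
    does not matter for summable families. *)
Lemma csumP {T} {X : set T} {g : T -> R[i]} :
  abs_summable X g -> has_sum X g (csum X g).
Proof.
move=> sg; suff [s gs] : exists s, has_sum X g s by rewrite (csum_eq _ gs).
move: g sg; apply: abs_summable_ind
  => [f f0 sf|f g _ _ [s fs] [t gt]|c f _ [s fs]].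
- by eexists; apply: has_sum_nneg.
- by eexists; apply: has_sumD fs gt.
- by eexists; apply: has_sumZ fs.
Qed.

Lemma csum_nneg {T} {X : set T} {f : T -> R} : (forall x, 0 <= f x) ->
    abs_summable X (fun x => (f x)%:C) ->
  csum X (fun x => (f x)%:C) = (fine (\esum_(x in X) (f x)%:E))%:C.
Proof. by move=> f0 sf; apply/csum_eq/has_sum_nneg. Qed.

Lemma csumD {T} {X : set T} {f g : T -> R[i]} :
    abs_summable X f -> abs_summable X g ->
  csum X (fun x => f x + g x) = csum X f + csum X g.
Proof. by move=> sf sg; apply/csum_eq/has_sumD; apply: csumP. Qed.

Lemma csumZ {T} {X : set T} c {f : T -> R[i]} : abs_summable X f ->
  csum X (fun x => c * f x) = c * csum X f.
Proof. by move=> sf; apply/csum_eq/has_sumZ/csumP. Qed.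

(** Both functions have the same finite sums inside [X], so [has_sum] is the same predicate and
    [xget] makes the same choice, even where no sum exists. *)
Lemma eq_csum {T} {X : set T} (f g : T -> R[i]) :
  (forall x, X x -> f x = g x) -> csum X f = csum X g.
Proof.
move=> fg; rewrite /csum; congr xget; apply/funext => s; apply/propext.
suff H (f' g' : T -> R[i]) : (forall x, X x -> f' x = g' x) ->
    has_sum X f' s -> has_sum X g' s.
  by split; apply: H => // x Xx; rewrite fg.
move=> fg' fs e e0; have [Y XY sY] := fs _ e0; exists Y => // Z XZ YZ.
rewrite -(@eq_fsbigr _ _ _ _ f')//; first exact: sY.
by move=> x; rewrite inE => Zx; apply: fg'; case: XZ => _; apply.
Qed.

Lemma csum_finite {T} {X : set T} (f : T -> R[i]) : finite_set X ->
  csum X f = \sum_(x \in X) f x.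
Proof.
move=> Xfin; apply: csum_eq => e e0; exists X; first exact: fsets_self.
move=> Y [_ YX] XY; have -> : Y = X by apply/seteqP.
by rewrite subrr cabs0.
Qed.

Lemma csumID {T} {A : set T} (B : set T) {f : T -> R[i]} : abs_summable A f ->
  csum A f = csum (A `&` B) f + csum (A `&` ~` B) f.
Proof.
have sI C (g : T -> R[i]) : abs_summable A g -> abs_summable (A `&` C) g.
  by apply: sub_abs_summable; apply: subIsetl.
(* [fine] is additive only on finite values. *)
have fin C (g : T -> R) : (forall x, 0 <= g x) ->
    abs_summable A (fun x => (g x)%:C) ->
    \esum_(x in A `&` C) (g x)%:E \is a fin_num.
  move=> g0 /(sI C); rewrite /abs_summable.
  under eq_esum do rewrite cabs_real ger0_norm//.
  by rewrite ge0_fin_numE// esum_ge0// => x _; rewrite lee_fin.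
move: f; apply: abs_summable_ind => [f f0 sf|f g sf sg IHf IHg|c f sf IHf].
- rewrite !csum_nneg//; try exact: sI.
  rewrite -raddfD/= -fineD; [|exact: fin|exact: fin].
  by congr (fine _)%:C; apply: esumID => x _; rewrite lee_fin.
- by rewrite !csumD//; [rewrite IHf IHg addrACA|exact: sI..].
- by rewrite !csumZ// ?IHf ?mulrDr//; exact: sI.
Qed.

Lemma reindex_abs_summable {T T' : choiceType} {P : set T} {Q : set T'}
    {e : T -> T'} (f : T' -> R[i]) : set_bij P Q e ->
  abs_summable Q f = abs_summable P (f \o e).
Proof. by move=> eb; rewrite /abs_summable (reindex_esum _ _ _ _ eb). Qed.

Lemma reindex_csum {T T' : choiceType} {P : set T} {Q : set T'}
    (e : T -> T') (f : T' -> R[i]) : set_bij P Q e -> abs_summable Q f ->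
  csum Q f = csum P (f \o e).
Proof.
move=> eb.
have sP (g : T' -> R[i]) : abs_summable Q g -> abs_summable P (g \o e).
  by rewrite (reindex_abs_summable _ eb).
move: f; apply: abs_summable_ind => [f f0 sf|f g sf sg IHf IHg|c f sf IHf].
- rewrite csum_nneg// (reindex_esum _ _ _ _ eb) -csum_nneg//.
  exact: sP sf.
- by rewrite csumD// IHf IHg -csumD//; exact: sP.
- by rewrite csumZ// IHf -csumZ//; exact: sP.
Qed.

(** Some finite sum is within [e] of [csum X f], and its modulus is at most a finite sum of moduli,
    hence at most the [\esum]. *)
Lemma cabs_csum_le {T} {X : set T} {f : T -> R[i]} : abs_summable X f ->
  ((cabs (csum X f))%:E <= \esum_(x in X) (cabs (f x))%:E)%E.
Proof.
move=> sf; apply/lee_addgt0Pr => e e0.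
have [Y XY sY] := csumP sf _ e0; case: (XY) => Yfin _.
have {}sY := sY _ XY (@subset_refl _ _).
have : cabs (csum X f) <= \sum_(x \in Y) cabs (f x) + e.
  have := cabs_fsum _ _ f Yfin.
  have := cabsD (\sum_(x \in Y) f x) (- (\sum_(x \in Y) f x - csum X f)).
  by rewrite cabsN opprB addrC subrK; lra.
rewrite -lee_fin => /le_trans; apply; rewrite EFinD leeD2r// -fsumEFin//.
by apply: esum_ge; exists Y.
Qed.

(** * Iterated sums and products of sums *)

Section Fubini.
Context {T1 T2 : choiceType} {I : set T1} {J : T1 -> set T2}.
Implicit Types f : T1 * T2 -> R[i].

Let nested f : abs_summable (I `*`` J) f ->
  (\esum_(i in I) \esum_(j in J i) (cabs (f (i, j)))%:E < +oo)%E.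
Proof.
move=> fs; rewrite esum_esum; last by move=> *; rewrite lee_fin cabs_ge0.
by apply: le_lt_trans fs; apply: le_esum => -[].
Qed.

Lemma abs_summable_section f i : abs_summable (I `*`` J) f -> I i ->
  abs_summable (J i) (fun j => f (i, j)).
Proof.
move=> /nested fs Ii; apply: le_lt_trans fs.
(* The section at [i] is one term of the outer sum, and the other terms are nonnegative. *)
rewrite (esumID [set i]); last first.
  by move=> *; apply: esum_ge0 => *; rewrite lee_fin cabs_ge0.
rewrite setI1 mem_set// esum_set1; last first.
  by apply: esum_ge0 => *; rewrite lee_fin cabs_ge0.
rewrite leeDl//; apply: esum_ge0 => *; apply: esum_ge0 => *.
by rewrite lee_fin cabs_ge0.
Qed.

Lemma abs_summable_csum f : abs_summable (I `*`` J) f ->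
  abs_summable I (fun i => csum (J i) (fun j => f (i, j))).
Proof.
move=> fs; apply: le_lt_trans (nested _ fs); apply: le_esum => i Ii.
exact/cabs_csum_le/abs_summable_section.
Qed.

(** For nonnegative terms every inner sum is the [fine] of a finite [\esum], and [esum_esum]
    applies; linearity does the rest. *)
Lemma csum_csum f : abs_summable (I `*`` J) f ->
  csum I (fun i => csum (J i) (fun j => f (i, j))) = csum (I `*`` J) f.
Proof.
move: f; apply: abs_summable_ind => [f f0 sf|f g sf sg IHf IHg|c f sf IHf].
- have sec i : I i -> abs_summable (J i) (fun j => (f (i, j))%:C).
    by move=> Ii; apply: (abs_summable_section _ _ sf).
  have secfin i : I i -> \esum_(j in J i) (f (i, j))%:E \is a fin_num.
    move=> Ii; rewrite ge0_fin_numE ?esum_ge0//; last first.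
      by move=> *; rewrite lee_fin.
    have := sec i Ii; rewrite /abs_summable.
    by under eq_esum do rewrite cabs_real ger0_norm//.
  have f'0 i : 0 <= fine (\esum_(j in J i) (f (i, j))%:E).
    by rewrite fine_ge0// esum_ge0// => *; rewrite lee_fin.
  rewrite csum_nneg// (@eq_csum _ I _
    (fun i => (fine (\esum_(j in J i) (f (i, j))%:E))%:C)); last first.
    by move=> i Ii; rewrite (csum_nneg _ (sec i Ii)).
  rewrite csum_nneg//; last first.
    apply: le_abs_summable (abs_summable_csum _ sf) => i Ii /=.
    by rewrite (csum_nneg _ (sec i Ii)).
  congr (fine _)%:C.
  transitivity (\esum_(i in I) \esum_(j in J i) (f (i, j))%:E).
    by apply: eq_esum => i Ii; rewrite fineK// secfin.
  rewrite esum_esum; last by move=> *; rewrite lee_fin.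
  by apply: eq_esum => x _; rewrite -surjective_pairing.
- rewrite csumD// -IHf -IHg -csumD; [|exact: abs_summable_csum..].
  by apply: eq_csum => i Ii; rewrite csumD//; exact: abs_summable_section.
- rewrite csumZ// -IHf -csumZ; last exact: abs_summable_csum.
  by apply: eq_csum => i Ii; rewrite csumZ//; exact: abs_summable_section.
Qed.

End Fubini.

(** For fixed [x], the inner sum of moduli is [cabs (f x)] times a finite constant, so the double
    sum is that of a multiple of [f]. *)
Lemma abs_summableM {T1 T2 : choiceType} {X : set T1} {Y : set T2}
    {f : T1 -> R[i]} {g : T2 -> R[i]} : abs_summable X f -> abs_summable Y g ->
  abs_summable (X `*` Y) (fun p => f p.1 * g p.2).
Proof.
move=> sf sg; rewrite /abs_summable -[X `*` Y]/(X `*`` fun=> Y).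
rewrite -(esum_esum (a := fun x y => (cabs (f x * g y))%:E)); last first.
  by move=> *; rewrite lee_fin cabs_ge0.
have Yfin : \esum_(y in Y) (cabs (g y))%:E \is a fin_num.
  by rewrite ge0_fin_numE// esum_ge0// => *; rewrite lee_fin cabs_ge0.
have sfg := abs_summableZ _ _ (fine (\esum_(y in Y) (cabs (g y))%:E))%:C _ sf.
apply: le_lt_trans sfg; apply: le_esum => x Xx.
under eq_esum do rewrite cabsM.
rewrite esumZ ?cabs_ge0//.
rewrite cabsM cabs_real ger0_norm ?fine_ge0 ?esum_ge0//; last first.
  by move=> *; rewrite lee_fin cabs_ge0.
by rewrite EFinM fineK// muleC.
Qed.

Lemma csumM {T1 T2 : choiceType} {X : set T1} {Y : set T2}
    {f : T1 -> R[i]} {g : T2 -> R[i]} : abs_summable X f -> abs_summable Y g ->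
  csum (X `*` Y) (fun p => f p.1 * g p.2) = csum X f * csum Y g.
Proof.
move=> sf sg; rewrite -[X `*` Y]/(X `*`` fun=> Y) -csum_csum;
  last exact: abs_summableM.
rewrite mulrC -csumZ//; apply: eq_csum => x _ /=.
by rewrite csumZ// mulrC.
Qed.

End Summation.

(** * Series over the naturals and Cauchy products *)

Section Series.
Context {R : realType}.

(** For nonnegative terms the unordered sum is the limit of the partial sums, so bounds on initial
    segments suffice. *)
Lemma esum_nat_le (P : pred nat) (f : nat -> R) (M : R) :
    (forall n, 0 <= f n) ->
    (forall N, \sum_(0 <= n < N | P n) f n <= M) ->
  (\esum_(n in [set n | P n]) (f n)%:E <= M%:E)%E.
Proof.
move=> f0 fM; rewrite -nneseries_esum; last by move=> *; rewrite lee_fin.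
apply: lime_le; first by apply: is_cvg_nneseries_cond => *; rewrite lee_fin.
by apply: nearW => N; rewrite sumEFin lee_fin.
Qed.

Lemma le_esum_nat (P : pred nat) (f : nat -> R) N : (forall n, 0 <= f n) ->
  ((\sum_(0 <= n < N | P n) f n)%:E <= \esum_(n in [set n | P n]) (f n)%:E)%E.
Proof.
move=> f0; rewrite -nneseries_esum; last by move=> *; rewrite lee_fin.
by rewrite -sumEFin; apply: nneseries_lim_ge => *; rewrite lee_fin.
Qed.

Lemma abs_summable_nat (u : nat -> R[i]) (M : R) :
  (forall N, \sum_(0 <= n < N) cabs (u n) <= M) -> abs_summable setT u.
Proof.
move=> uM; apply: (@le_lt_trans _ _ M%:E); last exact: ltry.
rewrite -set_true; apply: esum_nat_le => // n; exact: cabs_ge0.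
Qed.

Lemma partial_sum_abs_summable (u : nat -> R[i]) : abs_summable setT u ->
  exists M, forall N, \sum_(0 <= n < N) cabs (u n) <= M.
Proof.
move=> su; exists (fine (\esum_(n in setT) (cabs (u n))%:E)) => N.
rewrite -lee_fin fineK; last first.
  by rewrite ge0_fin_numE// esum_ge0// => *; rewrite lee_fin cabs_ge0.
by rewrite -set_true; apply: le_esum_nat => n; apply: cabs_ge0.
Qed.

Definition convolution (u v : nat -> R[i]) (n : nat) : R[i] :=
  \sum_(k < n.+1) u k * v (n - k)%N.

Lemma csum_convolution (u v : nat -> R[i]) :
  abs_summable setT u -> abs_summable setT v ->
  csum setT (convolution u v) = csum setT u * csum setT v.
Proof.
move=> su sv.
(* Maps the triangle of pairs [(n, k)] with [k <= n] bijectively onto the quadrant; row [n] becomes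
   the antidiagonal of sum [n]. *)
pose diag (p : nat * nat) := (p.2, p.1 - p.2)%N.
have diag_bij : set_bij ([set: nat] `*`` (fun n => `I_n.+1))
    ([set: nat] `*` [set: nat]) diag.
  split=> [//|[n k] [m l]|[k l] _]; last first.
    by exists (k + l, k)%N; rewrite /diag/=; [lia|rewrite addKn].
  by rewrite !inE/= /diag => -[_ /= ?] [_ /= ?] [? ?]; congr (_, _); lia.
rewrite -csumM// (reindex_csum _ _ diag_bij); last exact: abs_summableM.
rewrite -csum_csum; last first.
  by rewrite -(reindex_abs_summable _ diag_bij); exact: abs_summableM.
apply: eq_csum => n _; rewrite csum_finite; last exact: finite_II.
by rewrite /convolution (fsbig_ord _ _ (fun k => u k * v (n - k)%N)).
Qed.

(** After exchanging the sums, [u k] multiplies the first [N - k.+1] terms of [v], at most the whole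
    sum. The shift by one is there because [u] will be a sequence stripped of its term 0. *)
Lemma sum_conv_le (u v : nat -> R) N :
    (forall n, 0 <= u n) -> (forall n, 0 <= v n) ->
  \sum_(n < N) \sum_(k < n) u k * v (n - k.+1)%N <=
    (\sum_(k < N) u k) * \sum_(n < N) v n.
Proof.
move=> u0 v0.
have -> : \sum_(n < N) \sum_(k < n) u k * v (n - k.+1)%N =
    \sum_(k < N) u k * \sum_(k.+1 <= n < N) v (n - k.+1)%N.
  transitivity (\sum_(n < N) \sum_(k < N | (k < n)%N) u k * v (n - k.+1)%N).
    apply: eq_bigr => n _; have nN : (n <= N)%N by apply: ltnW.
    pose F k := u k * v (n - k.+1)%N.
    by rewrite -(big_ord_widen_cond _ xpredT F nN).
  rewrite (exchange_big_dep xpredT)//=; apply: eq_bigr => k _.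
  rewrite -mulr_sumr; congr (_ * _).
  rewrite (big_nat_widenl _ 0)//= big_mkord; exact: eq_bigl.
rewrite mulr_suml; apply: ler_sum => k _; apply: ler_wpM2l => //.
rewrite -(big_mkord xpredT) -{1}[k.+1]add0n big_addn.
under eq_bigr do rewrite addnK.
rewrite (@big_cat_nat _ _ _ (N - k.+1) 0 N)//= ?leq_subr// lerDl.
by apply: sumr_ge0.
Qed.

(* A discrete Gronwall step: [v n] is the convolution minus terms weighted by
   [u 1, u 2, ...], so the partial sums satisfy [t <= M + q t]. *)
Lemma convolution_abs_summable (u v : nat -> R[i]) (q : R) :
    u 0 = 1 -> q < 1 -> (forall N, \sum_(k < N) cabs (u k.+1) <= q) ->
    abs_summable setT (convolution u v) -> abs_summable setT v.
Proof.
move=> u01 q1 uq /partial_sum_abs_summable[M convM].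
apply: (abs_summable_nat _ (M / (1 - q))) => N.
rewrite ler_pdivlMr ?subr_gt0//.
have step n : cabs (v n) <= cabs (convolution u v n) +
    \sum_(k < n) cabs (u k.+1) * cabs (v (n - k.+1)%N).
  have -> : v n = convolution u v n - \sum_(k < n) u k.+1 * v (n - k.+1)%N.
    by rewrite /convolution big_ord_recl/= u01 mul1r subn0 addrK.
  rewrite (le_trans (cabsD _ _))// cabsN lerD2l (le_trans (cabs_sum _ _ _ _))//.
  by under eq_bigr do rewrite cabsM.
have : \sum_(0 <= n < N) cabs (v n) <= M + q * \sum_(0 <= n < N) cabs (v n).
  apply: le_trans (lerD (convM N) (ler_wpM2r _ (uq N))); last first.
    by apply: sumr_ge0 => *; apply: cabs_ge0.
  rewrite !big_mkord.
  have /(_ N) := sum_conv_le (fun n => cabs (u n.+1)) (fun n => cabs (v n)).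
  move=> /(_ (fun=> cabs_ge0 _) (fun=> cabs_ge0 _)) /= conv_le.
  apply: le_trans (lerD (lexx _) conv_le).
  by rewrite -big_split/=; apply: ler_sum => n _.
by rewrite mulrBr mulr1 mulrC; lra.
Qed.

End Series.

(** * Cutting and gluing walks *)

Section Walks.
Implicit Types (u v w : seq posnat) (n k m i : nat).

(* Meant for [u] ending at the first vertex of [v]. *)
Definition glue u v : seq posnat := u ++ behead v.

Lemma size_glue k m u v : size u = k.+1 -> size v = m.+1 ->
  size (glue u v) = (k + m).+1.
Proof. by move=> su sv; rewrite size_cat size_behead su sv. Qed.

Lemma nth_glue_left k u v i : size u = k.+1 -> (i <= k)%N ->
  nth pos1 (glue u v) i = nth pos1 u i.
Proof. by move=> su ik; rewrite nth_cat su ltnS ik. Qed.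

(** The shared vertex is stored in [u] only; its equality with the head of [v] settles [i = 0]. *)
Lemma nth_glue_right k u v i : size u = k.+1 -> nth pos1 u k = nth pos1 v 0 ->
  nth pos1 (glue u v) (k + i) = nth pos1 v i.
Proof.
move=> su uv; case: i => [|i]; first by rewrite addn0 (nth_glue_left k).
rewrite nth_cat su ifF; last by lia.
by rewrite nth_behead; congr nth; lia.
Qed.

Lemma walk_weight_glue (R : realType) (h : weight R) k m u v :
    size u = k.+1 -> size v = m.+1 -> nth pos1 u k = nth pos1 v 0 ->
  walk_weight h (glue u v) = walk_weight h u * walk_weight h v.
Proof.
move=> su sv uv; rewrite /walk_weight (size_glue k m)// su sv/= big_split_ord/=.
congr (_ * _); apply: eq_bigr => i _; last first.
  by rewrite -addnS !(nth_glue_right k).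
by rewrite !(nth_glue_left k)// ltnW.
Qed.

(** Written as a complement so that [csumID] splits [D_] directly; [no_returnP] gives the form used
    on vertices. *)
Definition no_return n : set (seq posnat) := W n `&` ~` W1 n.

Lemma no_returnP n w : no_return n w <->
  W n w /\ forall i, (1 <= i <= n)%N -> nth pos1 w i <> pos1.
Proof.
split=> -[Ww noret]; split=> //; last by case=> _ [i [/noret]].
by move=> i ? wi; apply: noret; split=> //; exists i.
Qed.

Lemma Wb_sub_W n : Wb n `<=` W n.
Proof. by move=> w [? []]. Qed.

(* Every walk from 1 splits uniquely at its last visit to 1. *)
Lemma glue_bij n :
  set_bij (`I_n.+1 `*`` (fun k => Wb k `*` no_return (n - k))) (W n)
    (fun p => glue p.2.1 p.2.2).
Proof.
split.
- move=> [k [u v]] [/= kn [/= [[su uE] [u0 uk]] /no_returnP[[[sv vE] v0] _]]].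
  have uv : nth pos1 u k = nth pos1 v 0 by rewrite uk v0.
  split; last by rewrite (nth_glue_left k).
  split; first by rewrite (size_glue k (n - k))// subnKC.
  move=> i ik; have [lt_ik|le_ki] := ltnP i k.
    by rewrite !(nth_glue_left k)//; [exact: uE|exact: ltnW].
  have -> : i = (k + (i - k))%N by rewrite subnKC.
  by rewrite -addnS !(nth_glue_right k)//; apply: vE; lia.
(* If [k < k'], the common walk is at 1 at time [k'], which is time [k' - k] of [v], a forbidden
   return. Using this both ways gives [k = k']. *)
- have last_visit k u v k' u' v' : (k' <= n)%N -> Wb k u ->
      no_return (n - k) v -> Wb k' u' -> no_return (n - k') v' ->
      glue u v = glue u' v' -> (k' <= k)%N.
    move=> k'n [[su _] [_ uk]] /no_returnP[[[sv _] v0] vE] [[su' _] [_ uk']] _.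
    move=> gE.
    rewrite leqNgt; apply/negP => lt_kk'; apply: (vE (k' - k)%N); first by lia.
    rewrite -(nth_glue_right k u v)//; last by rewrite uk v0.
    by rewrite subnKC ?(ltnW lt_kk')// gE (nth_glue_left k').
  move=> [k [u v]] [k' [u' v']]; rewrite !inE.
  move=> -[/= kn [/= Wu Wv]] [/= k'n [/= Wu' Wv']] gE.
  have kk' : k = k'.
    apply/anti_leq/andP; split; first exact: last_visit Wu' Wv' Wu Wv (esym gE).
    exact: last_visit Wu Wv Wu' Wv' gE.
  subst k'; case: Wu => [[su _] _]; case: Wu' => [[su' _] _].
  move: Wv Wv' gE => /no_returnP[[[sv _] v0] _] /no_returnP[[[sv' _] v'0] _].
  move/eqP; rewrite eqseq_cat ?su// => /andP[/eqP -> /eqP vv'].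
  (* [glue] forgets the heads of [v] and [v'], but both are 1. *)
  congr (_, (_, _)); case: v v' sv sv' v0 v'0 vv' => [//|a v] [//|a' v'] _ _ /=.
  by move=> -> -> ->.
- move=> w [[sw wE] w0].
  (* Time 0 is a visit to 1, so there is a last one, [k]. Vertex [k] goes into both pieces. *)
  have ex : exists k, (k <= n)%N && (nth pos1 w k == pos1).
    by exists 0%N; rewrite w0 eqxx.
  have [k /andP[kn /eqP wk] kmax] :=
    ex_maxnP ex (fun k (kP : (k <= n)%N && _) => proj1 (andP kP)).
  exists (k, (take k.+1 w, drop k w)); last first.
    by rewrite /glue/= -drop1 drop_drop add1n cat_take_drop.
  split=> //; split=> /=.
    split; [split|]; rewrite ?size_take ?sw.
    + by case: ltnP; lia.
    + by move=> i ik; rewrite !nth_take ?ltnS// 1?ltnW//; apply: wE; lia.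
    + by rewrite !nth_take.
  apply/no_returnP; split; first (split; [split|]).
  + by rewrite size_drop sw; lia.
  + by move=> i ik; rewrite !nth_drop addnS; apply: wE; lia.
  + by rewrite nth_drop addn0.
  (* A return at time [i >= 1] of the second piece is a visit at [k + i > k], against maximality. *)
  + move=> i ik; rewrite nth_drop => wi.
    have := kmax (k + i)%N; rewrite wi eqxx andbT => /(_ _); lia.
Qed.

End Walks.

(** * Coefficient identities between the series *)

Definition S_ {R : realType} (h : weight R) : fps R :=
  fun n => weight_of h (no_return n).

(** Reindexing by [glue_bij] turns the sum over [W n] into a finite sum over cutting times; for each
    time the weight is multiplicative and [csumM] factors the sum. *)
Lemma D_convolution {R : realType} {h : weight R} : light h ->
  D_ h = convolution (B_ h) (S_ h).
Proof.
move=> h_light; apply/funext => n.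
rewrite /D_ /weight_of (reindex_csum _ _ (glue_bij n) (h_light n)).
have s := h_light n; rewrite (reindex_abs_summable _ (glue_bij n)) in s.
rewrite -csum_csum// csum_finite; last exact: finite_II.
rewrite /convolution (fsbig_ord _ _ (fun k => B_ h k * S_ h (n - k)%N)).
apply: eq_fsbigr => k; rewrite inE => /= kn; rewrite -csumM.
- apply: eq_csum => -[u v] [/= [[su _] [_ uk]] [[[sv _] v0] _]].
  by rewrite (walk_weight_glue _ _ k (n - k))// uk v0.
- exact: sub_abs_summable (Wb_sub_W _) (h_light _).
- by apply: sub_abs_summable (h_light _); apply: subIsetl.
Qed.

Lemma D_split {R : realType} {h : weight R} : light h ->
  D_ h = (fun n => A_ h n + S_ h n).
Proof.
move=> h_light; apply/funext => n.
rewrite /D_ /weight_of (csumID (W1 n) (h_light n)).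
congr (csum _ _ + _); apply/seteqP.
by split=> [w []//|w [? ?]]; split=> //; split.
Qed.

(** The only walk of length 0 from 1 is the single vertex, with the empty product as weight. *)
Lemma B_at0 {R : realType} {h : weight R} : B_ h 0 = 1.
Proof.
have -> : B_ h 0 = csum [set [:: pos1]] (walk_weight h).
  congr csum; apply/seteqP; split=> [[|a [|b w]]|w ->] //.
  - by move=> [[//]].
  - by move=> [_ [/= -> _]].
  - by move=> [[]].
rewrite csum_finite; last exact: finite_set1.
by rewrite fsbig_set1 /walk_weight/= big_ord0.
Qed.

(** * The values at 1 *)

Theorem theorem2 (R : realType) (h : weight R)
  (h_light : light h)
  (D_at1 : exists_at1 (D_ h))
  (b_lt1 : (\sum_(1 <= n <oo) (cabs (B_ h n))%:E < 1%:E)%E) :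
  exists_at1 (B_ h) /\
  at1 (B_ h) <> 0 /\
  exists_at1 (A_ h) /\
  at1 (A_ h) = (1 - 1 / at1 (B_ h)) * at1 (D_ h).
Proof.
set bsum := (\sum_(1 <= n <oo) _)%E in b_lt1.
have bsum_ge0 : (0 <= bsum)%E.
  by apply: nneseries_ge0 => *; rewrite lee_fin cabs_ge0.
(* Being nonnegative and below 1, the extended real [bsum] is a real number. *)
have [q q1 qE] : exists2 q, q < 1 & bsum = q%:E.
  case: bsum bsum_ge0 b_lt1 => [q _|//|//]; rewrite lte_fin => q1.
  by exists q.
have bq N : \sum_(1 <= n < N) cabs (B_ h n) <= q.
  rewrite -lee_fin -qE -sumEFin.
  by apply: nneseries_lim_ge => *; rewrite lee_fin cabs_ge0.
have sB : exists_at1 (B_ h).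
  apply: (abs_summable_nat _ (1 + q)) => -[|N].
    by rewrite big_nil; have := bq 0%N; rewrite big_nil; lra.
  by rewrite big_ltn// B_at0 cabs_real normr1 lerD2l.
have B_neq0 : at1 (B_ h) <> 0.
  (* If [B(1) = 0], splitting off [b_0 = 1] leaves a tail with sum -1, whose modulus 1 would be at
     most [q < 1]. *)
  move=> B10; have := csumID [set n | (0 < n)%N] sB.
  rewrite -/(at1 _) B10 setTI.
  have -> : [set: nat] `&` ~` [set n | (0 < n)%N] = [set 0%N].
    apply/seteqP; split=> [n [_ /= /negP]|n /= ->]; last by split.
    by rewrite -eqn0Ngt => /eqP.
  rewrite (csum_finite _ (finite_set1 _)) fsbig_set1 B_at0 => /eqP.
  rewrite eq_sym addr_eq0 => /eqP Eb.
  have sB1 := sub_abs_summable [set n | (0 < n)%N] _ (@subsetT _ _) sB.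
  have := cabs_csum_le sB1; rewrite Eb cabsN cabs_real normr1.
  apply/negP; rewrite -ltNge; apply: le_lt_trans (_ : (q%:E < 1%:E)%E) => //.
  apply: esum_nat_le => [n|N]; first exact: cabs_ge0.
  by apply: le_trans (bq N); rewrite (big_nat_widenl 1 0).
have sS : abs_summable setT (S_ h).
  apply: (convolution_abs_summable _ _ q (@B_at0 R h) q1);
    last by rewrite -(D_convolution h_light).
  by move=> N; have := bq N.+1; rewrite big_add1 big_mkord.
(* The factor [-1] lets the lemmas on sums and scalar multiples apply. *)
have AE : A_ h = (fun n => D_ h n + (-1) * S_ h n).
  by apply/funext => n; rewrite D_split// mulN1r addrK.
have sNS := abs_summableZ _ _ (-1) _ sS.
split=> //; split=> //; split; first by rewrite AE; apply: abs_summableD.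
(* With [D(1) = B(1) S(1)] both sides become [B(1) S(1) - S(1)], after cancelling the nonzero [B(1)]
   on the right. *)
rewrite /at1 AE csumD// csumZ// {1 2}D_convolution// csum_convolution//.
rewrite -/(at1 (B_ h)) mulrBl mul1r mulN1r mul1r; congr (_ - _).
by rewrite mulKf//; apply/eqP.
Qed.
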